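(* Let $\ell \geqslant 0$ be an integer. There is a function $f$ such that for every finite graph $H$, every minimal $\ell$-path root $G$ of $H$ satisfies $|V(G)| \leqslant f(\ell, |V(H)|)$ and $|E(G)| \leqslant f(\ell, |V(H)|)$, and the number of pairwise non-isomorphic minimal $\ell$-path roots of $H$ is at most $f(\ell, |V(H)|)$.
   Context: All graphs are undirected and loopless; they may contain parallel edges and may be infinite. An $\ell$-path of a graph $G$ is a walk of length $\ell$ without repeated vertices (identified with its reverse). The $\ell$-path graph $\mathbb{P}_\ell(G)$ is the simple graph whose vertices are the $\ell$-paths of $G$, two of them being adjacent if the union of the two corresponding paths forms a path of length $\ell+1$ or a cycle of length $\ell+1$ in $G$. $G$ is an $\ell$-path root of $H$ if $\mathbb{P}_\ell(G) \cong H$; a minimal $\ell$-path root of $H$ is an $\ell$-path root of $H$ that is minimal with respect to the subgraph relation among $\ell$-path roots of $H$. *)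

(* Defs.v *)
From mathcomp Require Import all_boot.
From mathcomp Require Import boolp classical_sets functions cardinality.

Set Implicit Arguments.
Unset Strict Implicit.
Unset Printing Implicit Defensive.

Local Open Scope classical_set_scope.

(* [inc e] is the set of the two ends of [e].  It need not determine [e], which
   allows parallel edges; that the ends differ excludes loops. *)
Record graph : Type := Graph {
  vertex : Type;
  edge : Type;
  inc : edge -> set vertex;
  incP : forall e, exists u v, u <> v /\ inc e = [set u; v] }.

Definition finite_graph (G : graph) : Prop :=
  finite_set [set: vertex G] /\ finite_set [set: edge G].

Definition isomorphic (G H : graph) : Prop :=
  exists (f : vertex G -> vertex H) (g : edge G -> edge H),
    [/\ bijective f, bijective g & forall e, inc (g e) = f @` inc e].

Section Subgraph.
Variables (G : graph) (A : set (vertex G)) (B : set (edge G)).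
Hypothesis AB : forall e, B e -> inc e `<=` A.

Definition subgraph_inc (e : B) : set A := val @^-1` inc (val e).

Lemma subgraph_incP (e : B) :
  exists u v, u <> v /\ subgraph_inc e = [set u; v].
Proof.
have /AB eA : B (val e) by apply: set_mem; exact: valP.
have [u [v [uv euv]]] := incP (val e).
have uA : u \in A by apply/mem_set/eA; rewrite euv; left.
have vA : v \in A by apply/mem_set/eA; rewrite euv; right.
exists (exist _ u uA), (exist _ v vA); split; first by case.
apply/seteqP; split=> [x|x].
- rewrite /subgraph_inc /= euv => -[xu|xv]; [left|right]; exact: val_inj.
- by rewrite /subgraph_inc /= euv => -[->|->]; [left|right].
Qed.

Definition subgraph : graph := Graph subgraph_incP.

End Subgraph.

(* The sequence v_0, e_1, v_1, ..., e_m, v_m is encoded by the functions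
   i |-> v_i (for i <= m) and i |-> e_(i+1) (for i < m). *)
Definition walk_data (G : graph) (m : nat) : Type :=
  (('I_m.+1 -> vertex G) * ('I_m -> edge G))%type.

Section Walks.
Variables (G : graph) (m : nat).
Implicit Type w : walk_data G m.

Definition is_walk w : Prop :=
  forall i : 'I_m,
    inc (w.2 i) = [set w.1 (widen_ord (leqnSn m) i); w.1 (lift ord0 i)].

Definition reverse w : walk_data G m :=
  (fun i => w.1 (rev_ord i), fun i => w.2 (rev_ord i)).

Definition is_path w : Prop := is_walk w /\ injective w.1.

(* The condition on edges excludes going back and forth along one edge;
   two parallel edges do form a cycle of length 2. *)
Definition is_cycle w : Prop :=
  [/\ is_walk w,
      w.1 ord0 = w.1 ord_max,
      injective (fun i : 'I_m => w.1 (widen_ord (leqnSn m) i)) &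
      injective w.2].

(* A path is the class {w, reverse w} of a walk w without repeated vertices. *)
Definition paths : set (set (walk_data G m)) :=
  [set p | exists w, is_path w /\ p = [set w; reverse w]].

Definition path_vertices (p : set (walk_data G m)) : set (vertex G) :=
  \bigcup_(w in p) range w.1.

Definition path_edges (p : set (walk_data G m)) : set (edge G) :=
  \bigcup_(w in p) range w.2.

End Walks.

Arguments paths : clear implicits.

Section PathGraph.
Variables (G : graph) (l : nat).

(* For l = 0 the two paths have no edge, so their union is completed by the
   edge of the path c: the 0-path graph of G is G with parallel edges merged. *)
Definition path_adj (p q : paths G l) : Prop :=
  p <> q /\
  exists c : walk_data G l.+1,
    [/\ is_path c \/ is_cycle c,
        path_vertices (val p) `|` path_vertices (val q) = range c.1 &
        (0 < l)%N ->
        path_edges (val p) `|` path_edges (val q) = range c.2].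

Definition path_graph_edges : set (set (paths G l)) :=
  [set s | exists p q, path_adj p q /\ s = [set p; q]].

Lemma path_graph_incP (s : path_graph_edges) :
  exists p q, p <> q /\ val s = [set p; q].
Proof.
have [p [q [[pq _] spq]]] : path_graph_edges (val s)
  by apply: set_mem; exact: valP.
by exists p, q.
Qed.

Definition path_graph : graph := Graph path_graph_incP.

End PathGraph.

Definition path_root (l : nat) (H G : graph) : Prop :=
  isomorphic (path_graph G l) H.

Definition minimal_path_root (l : nat) (H G : graph) : Prop :=
  path_root l H G /\
  forall (A : set (vertex G)) (B : set (edge G))
         (AB : forall e, B e -> inc e `<=` A),
    path_root l H (subgraph AB) -> A = setT /\ B = setT.

(* Main.v *)
Require Import Defs.
From mathcomp Require Import all_boot.
From mathcomp Require Import boolp classical_sets functions cardinality.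

(** For l > 0 the union of all l-paths of G is a subgraph with the same l-path
    graph, because the path or cycle witnessing an adjacency is the union of
    two l-paths.  A minimal root is therefore covered by its l-paths, of which
    there are as many as vertices of H.  For l = 0 it suffices to keep one edge
    out of each class of parallel edges.  Finally, there are finitely many
    graphs up to isomorphism within given bounds on the vertices and edges. *)

Set Implicit Arguments.
Unset Strict Implicit.
Unset Printing Implicit Defensive.

Local Open Scope classical_set_scope.

(** * Injections, bijections and cardinality bounds *)

Lemma inj_card_le (X : Type) (T : finType) (f : X -> T) (N : nat) :
  injective f -> #|T| <= N -> ([set: X] #<= `I_N)%card.
Proof.
move=> f_inj leTN; pose g x : nat := enum_rank (f x).
have -> : [set: X] = g @^-1` `I_N.
  by apply/seteqP; split=> // x _ /=; apply: leq_trans leTN; exact: ltn_ord.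
by apply: card_ge_preimage => x y _ _ /val_inj/enum_rank_inj/f_inj.
Qed.

Lemma card_eq_inj (X : Type) (n : nat) :
  ([set: X] #= `I_n)%card -> exists f : X -> 'I_n, injective f.
Proof.
move=> /card_set_bijP[f [f_fun f_inj _]].
have ltf x : f x < n by apply: f_fun.
exists (fun x => Ordinal (ltf x)) => x y [].
by move=> /f_inj; apply; rewrite in_setT.
Qed.

(** Serves when labels exist but depend on choices: any choice of related labels is injective, since
    a label determines its object. *)
Lemma inj_of_rel (X T : Type) (r : X -> T -> Prop) :
  (forall x, exists t, r x t) ->
  (forall x y t, r x t -> r y t -> x = y) ->
  exists f : X -> T, injective f.
Proof.
move=> /choice[f rf] r_inj; exists f => x y fxy.
by apply: (r_inj _ _ (f x)); rewrite // fxy.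
Qed.

Lemma inj_surj_bijective (X Y : Type) (f : X -> Y) :
  injective f -> (forall y, exists x, f x = y) -> bijective f.
Proof.
move=> f_inj /choice[g gK]; exists g => // x.
by apply: f_inj; rewrite gK.
Qed.

Lemma bij_of_same_image (X Y S : Type) (f : X -> S) (g : Y -> S) :
  injective f -> injective g -> range f = range g ->
  exists h : X -> Y, bijective h /\ forall x, g (h x) = f x.
Proof.
move=> f_inj g_inj fg.
have /choice[h hP] x : exists y, g y = f x.
  have [y _ yx] : range g (f x) by rewrite -fg; exists x.
  by exists y.
exists h; split=> //; apply: inj_surj_bijective => [x y hxy|y].
  by apply: f_inj; rewrite -!hP hxy.
have [x _ xy] : range f (g y) by rewrite fg; exists y.
by exists x; apply: g_inj; rewrite hP.
Qed.

Lemma image_injective (X Y : Type) (f : X -> Y) (A B : set X) :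
  injective f -> f @` A = f @` B -> A = B.
Proof.
move=> f_inj fAB; apply/seteqP; split=> x Ax.
  have [y By /f_inj <-//] : (f @` B) (f x) by rewrite -fAB; exists x.
have [y By /f_inj <-//] : (f @` A) (f x) by rewrite fAB; exists x.
Qed.

Definition set_elt (X : Type) (A : set X) (x : X) (Ax : A x) : A :=
  exist (fun y => y \in A) x (mem_set Ax).

Lemma isomorphic_trans (G H K : graph) :
  isomorphic G H -> isomorphic H K -> isomorphic G K.
Proof.
move=> [f [g [f_bij g_bij fg]]] [f' [g' [f'_bij g'_bij fg']]].
exists (f' \o f), (g' \o g); split; try exact: bij_comp.
by move=> e; rewrite /= fg' fg image_comp.
Qed.

(** * Graphs with labels in finite sets, up to isomorphism *)

Section FiniteCodes.
Variables S T : finType.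

Definition graph_code : finType :=
  ({set S} * {set T} * {ffun T -> {set S}})%type.

(** The labellings need not be onto, so the labels in use are recorded along with the incidences;
    isolated vertices show up only in the first component. *)
Definition code (G : graph) (f : vertex G -> S) (g : edge G -> T) : graph_code :=
  ([set s | `[< range f s >]]%SET, [set t | `[< range g t >]]%SET,
   [ffun t => [set s | `[< exists e v, [/\ g e = t, inc e v & f v = s] >]]%SET]).

(** Vertices and edges of the two graphs are matched by equal labels; the third component of the
    code makes this matching respect incidence. *)
Lemma code_eq_isomorphic (G H : graph) (f : vertex G -> S) (g : edge G -> T)
    (f' : vertex H -> S) (g' : edge H -> T) :
  injective f -> injective g -> injective f' -> injective g' ->
  code f g = code f' g' -> isomorphic G H.
Proof.
move=> f_inj g_inj f'_inj g'_inj [/setP ff /setP gg /ffunP inc_eq].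
have {}ff : range f = range f'.
  apply/funext => s; move: (ff s); rewrite !inE => xs; exact: propext (asbool_eq_equiv xs).
have {}gg : range g = range g'.
  apply/funext => t; move: (gg t); rewrite !inE => xs; exact: propext (asbool_eq_equiv xs).
have [h [h_bij hE]] := bij_of_same_image f_inj f'_inj ff.
have [k [k_bij kE]] := bij_of_same_image g_inj g'_inj gg.
exists h, k; split=> // e.
have incE s : (exists e0 v, [/\ g e0 = g e, inc e0 v & f v = s]) <->
              (exists e0 v, [/\ g' e0 = g e, inc e0 v & f' v = s]).
  have /setP/(_ s) := inc_eq (g e); rewrite !ffunE !inE.
  exact: asbool_eq_equiv.
apply/seteqP; split=> [v' ev'|_ [v ev <-]].
  have [|e0 [v [/g_inj <- ev fv]]] := (incE (f' v')).2.
    by exists (k e), v'; rewrite kE.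
  by exists v => //; apply: f'_inj; rewrite hE.
have [|e0 [v' [e0e ev' fv]]] := (incE (f v)).1; first by exists e, v.
have -> : k e = e0 by apply: g'_inj; rewrite kE.
by have -> : h v = v' by apply: f'_inj; rewrite hE.
Qed.

End FiniteCodes.

(** * Walks, paths and path graphs of a subgraph *)

Section SubgraphWalks.
Variables (G : graph) (A : set (vertex G)) (B : set (edge G)).
Hypothesis AB : forall e, B e -> inc e `<=` A.
Let G' := subgraph AB.

Lemma subgraph_incE (e : edge G') (u v : vertex G') :
  inc e = [set u; v] <-> inc (val e) = [set val u; val v].
Proof.
(* Both ends of an edge in [B] lie in [A], so restricting its end set to [A] loses nothing. *)
have vA (x : vertex G) : inc (val e) x -> x \in A.
  by move=> ex; apply/mem_set/(AB _ ex)/set_mem/valP.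
split=> [euv|euv]; apply/seteqP; split=> x.
- move=> ex; have : (inc e) (exist _ x (vA _ ex)) by [].
  by rewrite euv => -[] <-; [left|right].
- have [eu ev] : inc e u /\ inc e v by rewrite euv; split; [left|right].
  by case=> ->.
- by rewrite /inc/= /subgraph_inc /= euv => -[/val_inj|/val_inj] ->;
    [left|right].
- by rewrite /inc/= /subgraph_inc /= euv => -[] ->; [left|right].
Qed.

Definition walk_in m (w : walk_data G' m) : walk_data G m :=
  (fun i => val (w.1 i), fun i => val (w.2 i)).

Lemma walk_in_inj m : injective (@walk_in m).
Proof.
move=> [v e] [v' e'] [/= vv ee]; congr pair; apply/funext => i; apply: val_inj.
  exact: (congr1 (@^~ i) vv).
exact: (congr1 (@^~ i) ee).
Qed.

Lemma walk_in_surj m (w : walk_data G m) :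
  (forall i, A (w.1 i)) -> (forall i, B (w.2 i)) -> exists w', walk_in w' = w.
Proof.
case: w => v e /= Av Be.
by exists (fun i => set_elt (Av i),
           fun i => set_elt (Be i)).
Qed.

Lemma walk_in_walk m (w : walk_data G' m) : is_walk (walk_in w) <-> is_walk w.
Proof. by split=> ww i; apply/subgraph_incE/ww. Qed.

Lemma walk_in_path m (w : walk_data G' m) : is_path (walk_in w) <-> is_path w.
Proof.
split=> -[/walk_in_walk ww w_inj]; split=> // i j.
  by move=> wij; apply: w_inj; rewrite /= wij.
by move=> /val_inj/w_inj.
Qed.

Lemma walk_in_cycle m (w : walk_data G' m) : is_cycle (walk_in w) <-> is_cycle w.
Proof.
split=> -[/walk_in_walk ww w0 v_inj e_inj]; split=> //.
- exact: val_inj.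
- by move=> i j wij; apply: v_inj; rewrite /= wij.
- by move=> i j wij; apply: e_inj; rewrite /= wij.
- by rewrite /= w0.
- by move=> i j /val_inj/v_inj.
- by move=> i j /val_inj/e_inj.
Qed.

Lemma walk_in_vertices m (w : walk_data G' m) :
  range (walk_in w).1 = val @` range w.1.
Proof. by rewrite image_comp. Qed.

Lemma walk_in_edges m (w : walk_data G' m) :
  range (walk_in w).2 = val @` range w.2.
Proof. by rewrite image_comp. Qed.

Lemma path_in_vertices m (p : set (walk_data G' m)) :
  path_vertices (@walk_in m @` p) = val @` path_vertices p.
Proof.
rewrite /path_vertices bigcup_image image_bigcup.
by apply: eq_bigcupr => w _; exact: walk_in_vertices.
Qed.

Lemma path_in_edges m (p : set (walk_data G' m)) :
  path_edges (@walk_in m @` p) = val @` path_edges p.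
Proof.
rewrite /path_edges bigcup_image image_bigcup.
by apply: eq_bigcupr => w _; exact: walk_in_edges.
Qed.

Lemma path_in_paths m (p : set (walk_data G' m)) :
  paths G' m p -> paths G m (@walk_in m @` p).
Proof.
move=> [w [/walk_in_path pw ->]]; exists (walk_in w); split=> //.
by rewrite image_setU !image_set1.
Qed.

End SubgraphWalks.

(** The second half of [path_adj] with its witness exposed, so that the witness can be required to
    lie in a subgraph. *)
Definition adj_witness (G : graph) (l : nat) (p q : paths G l)
    (c : walk_data G l.+1) : Prop :=
  [/\ is_path c \/ is_cycle c,
      path_vertices (val p) `|` path_vertices (val q) = range c.1 &
      (0 < l)%N -> path_edges (val p) `|` path_edges (val q) = range c.2].

(** Taking images under [walk_in] is injective on paths. The first hypothesis makes it onto, the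
    second reflects adjacency. The second asks only for some witness in the subgraph, because for
    $\ell = 0$ the edge of a given witness may have been deleted in favour of a parallel one. *)
Lemma subgraph_path_graph (G : graph) (l : nat) (A : set (vertex G))
    (B : set (edge G)) (AB : forall e, B e -> inc e `<=` A) :
  (forall w : walk_data G l, is_path w ->
     (forall i, A (w.1 i)) /\ (forall i, B (w.2 i))) ->
  (forall p q : paths G l, path_adj p q ->
     exists c, [/\ adj_witness p q c, forall i, A (c.1 i) &
                   forall i, B (c.2 i)]) ->
  isomorphic (path_graph (subgraph AB) l) (path_graph G l).
Proof.
move=> pathAB adjAB.
pose phi (p : paths (subgraph AB) l) : paths G l :=
  set_elt (path_in_paths (set_mem (valP p))).
have phi_inj : injective phi.
  move=> p q /(congr1 val)/= /(image_injective (@walk_in_inj _ _ _ AB l)).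
  exact: val_inj.
have phi_surj p : exists p', phi p' = p.
  have [w [pw pE]] := set_mem (valP p).
  have [/walk_in_surj/[apply]] := pathAB w pw; move=> /(_ AB)[w' w'E].
  have pw' : is_path w' by apply/walk_in_path; rewrite w'E.
  have pp' : paths (subgraph AB) l [set w'; reverse w'] by exists w'.
  exists (set_elt pp'); apply: val_inj => /=.
  (* [walk_in] commutes with [reverse] by computation, hence the rewriting back. *)
  by rewrite pE image_setU !image_set1 w'E -w'E.
have val_img (U U' : Type) (f : U -> U') (X Y Z : set U) : injective f ->
    f @` X `|` f @` Y = f @` Z <-> X `|` Y = Z.
  by move=> f_inj; rewrite -image_setU; split=> [/image_injective->|->].
have phi_adj p q : path_adj (phi p) (phi q) <-> path_adj p q.
  split=> [adj_pq|[pq [c [c_ok cv ce]]]].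
    split; first by move=> pq; apply: adj_pq.1; rewrite pq.
    have [c [[c_ok cv ce] cA cB]] := adjAB _ _ adj_pq.
    have [c' c'E] := walk_in_surj AB cA cB; subst c.
    exists c'; split.
    - by case: c_ok => [/walk_in_path|/walk_in_cycle]; [left|right].
    - move: cv; rewrite walk_in_vertices !path_in_vertices.
      by move/val_img; apply; exact: val_inj.
    - move=> /ce; rewrite walk_in_edges !path_in_edges.
      by move/val_img; apply; exact: val_inj.
  split; first by move=> /phi_inj.
  exists (walk_in c); split.
  - by case: c_ok => [/walk_in_path|/walk_in_cycle]; [left|right].
  - rewrite walk_in_vertices !path_in_vertices.
    by apply/val_img => //; exact: val_inj.
  - move=> /ce {}ce; rewrite walk_in_edges !path_in_edges.
    by apply/val_img => //; exact: val_inj.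
(* An edge of the path graph is its own set of ends, so [phi] must act on edges by direct image, and
   compatibility with incidence is immediate. *)
have psiP (s : path_graph_edges (G := subgraph AB) (l := l)) :
    path_graph_edges (phi @` val s).
  have [p [q [pq ->]]] := set_mem (valP s).
  by exists (phi p), (phi q); rewrite phi_adj image_setU !image_set1.
exists phi, (fun s => set_elt (psiP s)); split=> //.
  exact: inj_surj_bijective.
apply: inj_surj_bijective => [s t /(congr1 val)/= /(image_injective phi_inj)|s].
  exact: val_inj.
have [p [q [pq sE]]] := set_mem (valP s).
have [[p' p'E] [q' q'E]] := (phi_surj p, phi_surj q); subst p q.
have st : path_graph_edges [set p'; q'] by exists p', q'; rewrite -phi_adj.
exists (set_elt st); apply: val_inj => /=.
by rewrite sE image_setU !image_set1.
Qed.

(** * Labelling the vertices and edges covered by paths *)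

Section PathRoot.
Variables (G H : graph) (l n : nat).
Hypotheses (root_G : path_root l H G) (card_H : ([set: vertex H] #= `I_n)%card).

(** The $\ell$-paths of [G] are the vertices of its path graph, hence in bijection with those of
    [H]. Since [rep] picks one of two orientations, a walk is recovered only up to reversal. *)
Lemma walk_index : exists (idx : paths G l -> 'I_n)
    (rep : paths G l -> walk_data G l),
  injective idx /\
  forall w, is_path w -> exists p, rep p = w \/ rep p = reverse w.
Proof.
have [h h_inj] := card_eq_inj card_H.
have [f [_ [/bij_inj f_inj _ _]]] := root_G.
have /choice[rep repP] (p : paths G l) : exists w, val p = [set w; reverse w].
  by have [w [_ ->]] := set_mem (valP p); exists w.
exists (h \o f), rep; split; first exact: inj_comp.
move=> w pw; have pp : paths G l [set w; reverse w] by exists w.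
exists (set_elt pp).
have /= wE := repP (set_elt pp).
set r := rep _ in wE *.
have : [set w; reverse w] r by rewrite wE; left.
by [].
Qed.

(** A vertex is labelled by the index of an $\ell$-path through it and its position there, mirrored
    if [rep] has the opposite orientation. Path and position determine the vertex. *)
Lemma covered_vertices_inj :
  (forall v : vertex G, exists w : walk_data G l,
     is_path w /\ exists i, w.1 i = v) ->
  exists f : vertex G -> 'I_n * 'I_l.+1, injective f.
Proof.
move=> cover; have [idx [rep [idx_inj repP]]] := walk_index.
apply: (@inj_of_rel _ _ (fun v t =>
  exists p, idx p = t.1 /\ (rep p).1 t.2 = v)).
  move=> v; have [w [/repP[p pw] [i wi]]] := cover v.
  case: pw => pw; first by exists (idx p, i), p; rewrite pw.
  by exists (idx p, rev_ord i), p; rewrite pw /= rev_ordK.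
by move=> v v' t [p [pt <-]] [q [qt <-]]; rewrite (idx_inj p q) ?pt ?qt.
Qed.

Lemma covered_edges_inj :
  (forall e : edge G, exists w : walk_data G l,
     is_path w /\ exists i, w.2 i = e) ->
  exists f : edge G -> 'I_n * 'I_l, injective f.
Proof.
move=> cover; have [idx [rep [idx_inj repP]]] := walk_index.
apply: (@inj_of_rel _ _ (fun e t =>
  exists p, idx p = t.1 /\ (rep p).2 t.2 = e)).
  move=> e; have [w [/repP[p pw] [i wi]]] := cover e.
  case: pw => pw; first by exists (idx p, i), p; rewrite pw.
  by exists (idx p, rev_ord i), p; rewrite pw /= rev_ordK.
by move=> e e' t [p [pt <-]] [q [qt <-]]; rewrite (idx_inj p q) ?pt ?qt.
Qed.

End PathRoot.

(** * Consequences of minimality *)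

Lemma minimal_root_covered (G H : graph) (l : nat) :
  0 < l -> minimal_path_root l H G ->
  (forall v : vertex G, exists w : walk_data G l,
     is_path w /\ exists i, w.1 i = v) /\
  (forall e : edge G, exists w : walk_data G l,
     is_path w /\ exists i, w.2 i = e).
Proof.
move=> l_gt0 [root_G min_G].
pose A := [set v : vertex G | exists w : walk_data G l,
  is_path w /\ exists i, w.1 i = v].
(* For $\ell = 0$ this set would be empty, as 0-paths have no edges. *)
pose B := [set e : edge G | exists w : walk_data G l,
  is_path w /\ exists i, w.2 i = e].
have AB e : B e -> inc e `<=` A.
  move=> [w [pw [i <-]]] v; rewrite pw.1 => -[->|->]; exists w; split=> //.
    by exists (widen_ord (leqnSn l) i).
  by exists (lift ord0 i).
have pathAB (w : walk_data G l) : is_path w -> (forall i, A (w.1 i)) /\ (forall i, B (w.2 i)).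
  by move=> pw; split=> i; exists w; split=> //; exists i.
(* The disjunction avoids showing that the reverse of a path is a path; vertices and edges are the
   same either way. *)
have walks_in (p : paths G l) (w : walk_data G l) : val p w -> is_path w \/ is_path (reverse w).
  have [w0 [pw0 ->]] := set_mem (valP p).
  have rK (u : walk_data G l) : reverse (reverse u) = u.
    by case: u => v e; congr pair; apply/funext => i /=; rewrite rev_ordK.
  by case=> ->; [left|right]; rewrite ?rK.
have vA (p : paths G l) : path_vertices (val p) `<=` A.
  move=> _ [w /walks_in[] pw [i _ <-]]; first exact: (pathAB w pw).1.
  by have := (pathAB _ pw).1 (rev_ord i); rewrite /= rev_ordK.
have eB (p : paths G l) : path_edges (val p) `<=` B.
  move=> _ [w /walks_in[] pw [i _ <-]]; first exact: (pathAB w pw).2.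
  by have := (pathAB _ pw).2 (rev_ord i); rewrite /= rev_ordK.
have [] := min_G A B AB.
  (* The given witness already lies in the subgraph: its vertices and, as [0 < l], its edges are
     those of [p] and [q]. *)
  apply: isomorphic_trans root_G; apply: subgraph_path_graph => // p q [_ [c cP]].
  exists c; split=> // i; case: cP => _ cv ce.
    have : (range c.1) (c.1 i) by exists i.
    by rewrite -cv => -[/vA|/vA].
  have : (range c.2) (c.2 i) by exists i.
  by rewrite -ce // => -[/eB|/eB].
by move=> At Bt; split=> [v|e]; [change (A v); rewrite At|change (B e); rewrite Bt].
Qed.

(** Injectivity of [inc] means that no edges are parallel; it lets edges be labelled by their ends,
    which replaces the covering by paths when $\ell = 0$. *)
Lemma minimal_root0_simple (G H : graph) :
  minimal_path_root 0 H G -> injective (@inc G).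
Proof.
move=> [root_G min_G].
(* The representative is chosen from the end set alone, so parallel edges share it; [None] stands
   for a set that is not the end set of an edge. *)
have /choice[r rP] (s : set (vertex G)) : exists o : option (edge G),
    if o is Some e then inc e = s else forall e, inc e <> s.
  have [[e es]|no] := pselect (exists e : edge G, inc e = s).
    by exists (Some e).
  by exists None => e es; apply: no; exists e.
pose B := [set e : edge G | r (inc e) = Some e].
have AB e : B e -> inc e `<=` setT by [].
have BP e : exists e', B e' /\ inc e' = inc e.
  have := rP (inc e); case re: (r _) => [e'|]; last by move=> /(_ e).
  by move=> ee; exists e'; split=> //; rewrite /B /= ee.
suff [_ Bt] : setT = [set: vertex G] /\ B = setT.
  have rE e : r (inc e) = Some e by have : B e by rewrite Bt.
  by move=> e e' ee; apply: Some_inj; rewrite -!rE ee.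
apply: (min_G _ _ AB); apply: isomorphic_trans root_G.
apply: subgraph_path_graph => [w _|p q [_ [c [c_ok cv _]]]].
  by split=> // -[].
have /choice[s sP] := BP.
have cw : is_walk c -> is_walk (c.1, s \o c.2).
  by move=> cw i; rewrite /= (sP _).2 cw.
(* The edge of the witness is replaced by the representative parallel to it, on the same
   vertices. *)
exists (c.1, s \o c.2); split=> //; last by move=> i; exact: (sP _).1.
split=> //; case: c_ok => [[/cw ? ?]|[/cw ? ? ? ?]]; [left|right]; split=> //.
(* A walk of length 1 has one edge, so its edge map stays injective. *)
by move=> i j _; rewrite !ord1.
Qed.

(** * Size and number of minimal roots *)

Lemma minimal_roots_bound (l : nat) (S T : nat -> finType) :
  (forall (H G : graph) n, ([set: vertex H] #= `I_n)%card ->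
     minimal_path_root l H G ->
     (exists f : vertex G -> S n, injective f) /\
     (exists g : edge G -> T n, injective g)) ->
  exists f : nat -> nat,
    forall (H : graph) (n : nat), ([set: vertex H] #= `I_n)%card ->
      (forall G : graph, minimal_path_root l H G ->
         ([set: vertex G] #<= `I_(f n))%card /\
         ([set: edge G] #<= `I_(f n))%card) /\
      (forall (I : Type) (G : I -> graph),
         (forall i, minimal_path_root l H (G i)) ->
         (forall i j, i <> j -> ~ isomorphic (G i) (G j)) ->
         ([set: I] #<= `I_(f n))%card).
Proof.
move=> injP.
(* The summands bound the vertices, the edges and the number of isomorphism classes, in this
   order. *)
exists (fun n => #|S n| + #|T n| + #|graph_code (S n) (T n)|) => H n card_H.
split=> [G /(injP _ _ _ card_H)[[f f_inj] [g g_inj]]|I G min_G niso].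
  split; first by apply: (inj_card_le f_inj); rewrite -addnA leq_addr.
  by apply: (inj_card_le g_inj); rewrite addnAC leq_addl.
(* A root is related to its codes under all injective labellings; roots sharing a code are
   isomorphic, hence have the same index. *)
pose r i (c : graph_code (S n) (T n)) :=
  exists f g, [/\ injective f, injective g & c = code (G := G i) f g].
have [||F F_inj] := @inj_of_rel _ _ r.
- move=> i; have [[f f_inj] [g g_inj]] := injP _ _ _ card_H (min_G i).
  by exists (code f g), f, g.
- move=> i j c [f [g [f_inj g_inj ->]]] [f' [g' [f'_inj g'_inj cc]]].
  apply: contrapT => /niso; apply; exact: code_eq_isomorphic cc.
by apply: (inj_card_le F_inj); rewrite leq_addl.
Qed.

Theorem theorem1p4 (l : nat) :
  exists f : nat -> nat -> nat,
    forall (H : graph) (n : nat),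
      finite_graph H -> ([set: vertex H] #= `I_n)%card ->
      (forall G : graph, minimal_path_root l H G ->
         ([set: vertex G] #<= `I_(f l n))%card /\
         ([set: edge G] #<= `I_(f l n))%card) /\
      (forall (I : Type) (G : I -> graph),
         (forall i, minimal_path_root l H (G i)) ->
         (forall i j, i <> j -> ~ isomorphic (G i) (G j)) ->
         ([set: I] #<= `I_(f l n))%card).
Proof.
suff [S [T /minimal_roots_bound[f fP]]] : exists S T : nat -> finType,
    forall (H G : graph) n, ([set: vertex H] #= `I_n)%card ->
    minimal_path_root l H G ->
    (exists f : vertex G -> S n, injective f) /\
    (exists g : edge G -> T n, injective g).
  by exists (fun=> f) => H n _; exact: fP.
case: l => [|l].
  (* For $\ell = 0$ each vertex is itself a path with one position, and an edge is labelled by the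
     set of labels of its ends. *)
  exists (fun n => 'I_n * 'I_1)%type, (fun n => {set 'I_n * 'I_1})%type.
  move=> H G n card_H min_G.
  have [v|f f_inj] := covered_vertices_inj min_G.1 card_H.
    have e0 (i : 'I_0) : edge G by case: i.
    exists (fun=> v, e0); split; last by exists ord0.
    by split=> [[]//|i j _]; rewrite !ord1.
  split; first by exists f.
  exists (fun e => [set s | `[< (f @` inc e) s >]]%SET) => e e' /setP ee.
  apply: (minimal_root0_simple min_G); apply: (image_injective f_inj).
  apply/funext => s; have := ee s; rewrite !inE => es.
  exact: propext (asbool_eq_equiv es).
(* The length is now [l.+1], so a path has [l.+2] vertices and [l.+1] edges. *)
exists (fun n => 'I_n * 'I_l.+2)%type, (fun n => 'I_n * 'I_l.+1)%type.
move=> H G n card_H min_G.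
have [cover_v cover_e] := minimal_root_covered (ltn0Sn l) min_G.
split; first exact: covered_vertices_inj min_G.1 card_H cover_v.
exact: covered_edges_inj min_G.1 card_H cover_e.
Qed.
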